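(* Let $\mathcal{H}$ be a $3$-regular tripartite $3$-uniform hypergraph. Then $\mathcal{H}$ has a spanning subhypergraph whose degrees are all either $1$ or $2$.
   Context: A hypergraph $\mathcal{H}$ consists of a finite vertex set $V(\mathcal{H})$ and a set $E(\mathcal{H})$ of subsets of $V(\mathcal{H})$, called edges. It is $3$-uniform if every edge has exactly $3$ vertices, and $3$-regular if every vertex lies in exactly $3$ edges. A $3$-uniform hypergraph is tripartite if its vertex set can be partitioned into three sets such that every edge contains exactly one vertex from each of them. A spanning subhypergraph $\mathcal{C}$ of $\mathcal{H}$ is a hypergraph with $V(\mathcal{C})=V(\mathcal{H})$ and $E(\mathcal{C})\subseteq E(\mathcal{H})$; the degree of a vertex in it is the number of edges of $\mathcal{C}$ containing that vertex. *)

(* Defs.v *)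
From HB Require Import structures.
From mathcomp Require Import all_boot.

Set Implicit Arguments.
Unset Strict Implicit.
Unset Printing Implicit Defensive.

(* The vertex set is a finite set of points of an ambient finite type, so that
   a hypergraph and its subhypergraphs live over the same type. Edges form a
   set: there are no repeated edges. *)
Record hypergraph (T : finType) := Hypergraph {
  vertices : {set T};
  edges : {set {set T}};
  edges_sub : forall e, e \in edges -> e \subset vertices
}.

Definition degree (T : finType) (H : hypergraph T) (v : T) : nat :=
  #|[set e in edges H | v \in e]|.

Definition uniform (T : finType) (k : nat) (H : hypergraph T) : Prop :=
  forall e, e \in edges H -> #|e| = k.

Definition regular (T : finType) (k : nat) (H : hypergraph T) : Prop :=
  forall v, v \in vertices H -> degree H v = k.

(* The parts may be empty, which only matters when there are no edges. *)
Definition tripartite (T : finType) (H : hypergraph T) : Prop :=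
  exists A B C : {set T},
    [/\ A :|: B :|: C = vertices H,
        [/\ [disjoint A & B], [disjoint A & C] & [disjoint B & C]] &
        forall e, e \in edges H ->
          [/\ #|e :&: A| = 1, #|e :&: B| = 1 & #|e :&: C| = 1]].

Definition spanning_subhypergraph (T : finType) (C H : hypergraph T) : Prop :=
  vertices C = vertices H /\ edges C \subset edges H.

(* Main.v *)
Require Import Defs.
From mathcomp Require Import all_boot all_order all_algebra.

(**
   Two-colour the edges so that every vertex sees both colours, following
   Seymour's linear algebra argument.  For a nonempty set [Z] of edges, the
   vertices all of whose edges lie in [Z] impose linear equations "the weights
   of the edges at [v] sum to [0]" on weights on [Z].  Each part contributes at
   most [#|Z| / 3] equations, and if two parts reach this bound then both sum
   up to the equation "the total weight is [0]", so one equation is redundant.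
   Hence there is a nonzero solution.  Colouring by sign settles every vertex
   on an edge of nonzero weight; recurse on the edges of weight zero.
*)

Set Implicit Arguments.
Unset Strict Implicit.
Unset Printing Implicit Defensive.

Import Order.TTheory GRing.Theory Num.Theory.

Lemma underdetermined_system (F : fieldType) (I J : finType) (Z : {set I})
    (W : {set J}) (a : I -> J -> F) :
  #|W| < #|Z| ->
  exists x : I -> F,
    (exists2 i, i \in Z & x i != 0%R) /\
    forall j, j \in W -> (\sum_(i in Z) x i * a i j = 0)%R.
Proof.
move=> ltWZ.
pose M : 'M[F]_(#|Z|, #|W|) := (\matrix_(i, j) a (enum_val i) (enum_val j))%R.
(* [M] has more rows than columns, so its left kernel is nonzero; a nonzero row of it, extended by 0
   outside [Z], gives the weights. *)
have kerM : kermx M != 0%R.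
  by rewrite -mxrank_eq0 mxrank_ker subn_eq0 -ltnNge (leq_ltn_trans (rank_leq_col M)).
pose u := nz_row (kermx M).
have uM : (u *m M = 0)%R by apply/sub_kermxP/nz_row_sub.
have /rV0Pn[k uk] : u != 0%R by rewrite nz_row_eq0.
have Zk := enum_valP k.
exists (fun i => if i \in Z then u ord0 (enum_rank_in Zk i) else 0%R).
split=> [|j Wj].
  by exists (enum_val k); rewrite // Zk enum_valK_in.
transitivity ((u *m M)%R ord0 (enum_rank_in Wj j)); last by rewrite uM mxE.
rewrite mxE big_enum_val; apply: eq_bigr => i _.
by rewrite enum_valP enum_valK_in mxE enum_rankK_in.
Qed.

(** Without a positive term, the negated terms would be nonnegative with sum 0, so all would vanish.
    Applied to the weights and to their negations, this yields an edge of each sign. *)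
Lemma sum0_pos (R : realDomainType) (I : finType) (P : pred I) (x : I -> R) i :
  (\sum_(j | P j) x j = 0)%R -> P i -> x i != 0%R ->
  exists2 j, P j & (0 < x j)%R.
Proof.
move=> x0 Pi xi; apply/exists_inP; apply: contraNT xi => /exists_inPn xle0.
rewrite -oppr_eq0; have /psumr_eq0P -> // : (\sum_(j | P j) - x j = 0)%R.
  by rewrite sumrN x0 oppr0.
by move=> j Pj; rewrite oppr_ge0 leNgt xle0.
Qed.

Section Weights.

Variables (T : finType) (E Z : {set {set T}}).
Hypothesis subZE : Z \subset E.

(** When [Z] consists of the edges still to be coloured, these are the vertices still to be
    settled. *)
Definition enclosed : {set T} := [set v | [forall e in E, (v \in e) ==> (e \in Z)]].

Lemma enclosedP v :
  reflect (forall e, e \in E -> v \in e -> e \in Z) (v \in enclosed).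
Proof.
rewrite inE; apply: (iffP forall_inP) => vZ e Ee; first exact/implyP/vZ.
exact/implyP/vZ.
Qed.

Lemma enclosed_star {R : Type} (idx : R) (op : Monoid.com_law idx) v
    (F : {set T} -> R) :
  v \in enclosed ->
  \big[op/idx]_(e in Z | v \in e) F e = \big[op/idx]_(e in E | v \in e) F e.
Proof.
move=> /enclosedP vZ; apply: eq_bigl => e.
apply/andP/andP=> -[He ve]; split=> //; first exact: (subsetP subZE).
exact: vZ.
Qed.

Variable D : {set T}.
Hypothesis edge_meets : forall e, e \in E -> #|e :&: D| = 1.
Hypothesis degD : forall v, v \in D -> #|[set e in E | v \in e]| = 3.

(** Double counting of incidences: an enclosed vertex of [D] has all three of its edges in [Z]. *)
Lemma card_enclosed_part :
  3 * #|D :&: enclosed| = \sum_(e in Z) #|e :&: (D :&: enclosed)|.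
Proof.
rewrite mulnC -sum_nat_const.
transitivity (\sum_(v in D :&: enclosed) \sum_(e in Z | v \in e) 1).
  apply: eq_bigr => v /setIP[Dv vZ]; rewrite enclosed_star // -(degD Dv).
  by rewrite -sum1_card; apply: eq_bigl => e; rewrite inE.
rewrite (exchange_big_dep (mem Z)) /=; last by move=> v e _ /andP[].
apply: eq_bigr => e Ze; rewrite -sum1_card; apply: eq_bigl => v.
by rewrite [RHS]inE Ze andbC.
Qed.

Lemma card_meets_enclosed e : e \in Z -> #|e :&: (D :&: enclosed)| <= 1.
Proof.
move=> Ze; rewrite -(edge_meets (subsetP subZE _ Ze)).
by apply: subset_leq_card; rewrite setIA subsetIl.
Qed.

Lemma card_enclosed_le : 3 * #|D :&: enclosed| <= #|Z|.
Proof.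
by rewrite card_enclosed_part -sum1_card leq_sum // => e /card_meets_enclosed.
Qed.

(** In the tight case every edge of [Z] meets [D :&: enclosed] exactly once, so exchanging the sums
    counts each weight once. *)
Lemma sum_enclosed_part (R : nmodType) (x : {set T} -> R) :
  3 * #|D :&: enclosed| = #|Z| ->
  (\sum_(v in D :&: enclosed) \sum_(e in Z | v \in e) x e = \sum_(e in Z) x e)%R.
Proof.
move=> tight.
have meet1 e : e \in Z -> #|e :&: (D :&: enclosed)| = 1.
  move=> Ze; apply/eqP.
  have [_] := leqif_sum (fun e (Ze : e \in Z) => leqif_eq (card_meets_enclosed Ze)).
  by rewrite -card_enclosed_part sum1_card tight eqxx => /esym/forall_inP; apply.
rewrite (exchange_big_dep (mem Z)) /=; last by move=> v e _ /andP[].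
apply: eq_bigr => e Ze; rewrite sumr_const -[RHS]mulr1n -(meet1 e Ze).
by congr Algebra.natmul; apply: eq_card => v; rewrite [RHS]inE unfold_in Ze andbC.
Qed.

End Weights.

Section Tripartite.

Variables (T : finType) (E : {set {set T}}) (A B C : {set T}).
Hypothesis disjAB : [disjoint A & B].
Hypothesis meetA : forall e, e \in E -> #|e :&: A| = 1.
Hypothesis meetB : forall e, e \in E -> #|e :&: B| = 1.
Hypothesis meetC : forall e, e \in E -> #|e :&: C| = 1.
Hypothesis deg3 : forall v, v \in A :|: B :|: C -> #|[set e in E | v \in e]| = 3.

Lemma balanced_weights (Z : {set {set T}}) :
  Z \subset E -> Z != set0 ->
  exists x : {set T} -> rat,
    (exists2 e, e \in Z & x e != 0%R) /\
    forall v, v \in (A :|: B :|: C) :&: enclosed E Z ->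
      (\sum_(e in Z | v \in e) x e = 0)%R.
Proof.
move=> subZE Zn0; set X := enclosed E Z.
have degA v : v \in A -> #|[set e in E | v \in e]| = 3.
  by move=> Av; apply: deg3; rewrite !inE Av.
have degB v : v \in B -> #|[set e in E | v \in e]| = 3.
  by move=> Bv; apply: deg3; rewrite !inE Bv orbT.
have degC v : v \in C -> #|[set e in E | v \in e]| = 3.
  by move=> Cv; apply: deg3; rewrite !inE Cv orbT.
have leA := card_enclosed_le subZE meetA degA; rewrite -/X in leA.
have leB := card_enclosed_le subZE meetB degB; rewrite -/X in leB.
have leC := card_enclosed_le subZE meetC degC; rewrite -/X in leC.
have Zgt0 : 0 < #|Z| by rewrite card_gt0.
have sys (W : {set T}) : #|W| < #|Z| ->
  exists x : {set T} -> rat,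
    (exists2 e, e \in Z & x e != 0%R) /\
    forall v, v \in W -> (\sum_(e in Z | v \in e) x e = 0)%R.
  pose a (e : {set T}) (v : T) : rat := ((v \in e)%:R)%R.
  case/(underdetermined_system a) => x [xn0 xW]; exists x; split=> // v Wv.
  rewrite -[RHS](xW v Wv) big_mkcondr; apply: eq_bigr => e _.
  by rewrite /a; case: (v \in e); rewrite (mulr1, mulr0).
have cardU : #|(A :|: B :|: C) :&: X| <= #|A :&: X| + #|B :&: X| + #|C :&: X|.
  rewrite !setIUl (leq_trans (leq_card_setU _ _)) // leq_add2r.
  exact: leq_card_setU.
(* With fewer than [#|Z|] equations, counting unknowns suffices; otherwise the bounds for [A] and
   [B] are attained. *)
have [ltZ | geZ] := ltnP (#|A :&: X| + #|B :&: X| + #|C :&: X|) #|Z|.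
  by apply: sys; apply: leq_ltn_trans ltZ.
have geZ3 : 3 * #|Z| <= 3 * #|A :&: X| + 3 * #|B :&: X| + 3 * #|C :&: X|.
  by rewrite -!mulnDr leq_mul2l.
have tight (a b c z : nat) :
    a <= z -> b <= z -> c <= z -> 3 * z <= a + b + c -> a = z.
  move=> az bz cz z3; apply/eqP; rewrite eqn_leq az /=.
  rewrite -(leq_add2r (z + z)) addnA; apply: leq_trans (leq_trans z3 _).
    by rewrite !mulSn mul0n addn0 addnA.
  by rewrite -addnA leq_add2l leq_add.
have eqA : 3 * #|A :&: X| = #|Z| by apply: tight leA leB leC geZ3.
have eqB : 3 * #|B :&: X| = #|Z|.
  by apply: tight leB leA leC _; rewrite [X in _ <= X + _]addnC.
(* The equation at [w] is the one to drop: there are at most [#|Z|] equations, so one fewer leaves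
   the system underdetermined. *)
have /card_gt0P[w AXw] : 0 < #|A :&: X|.
  by move: Zgt0; rewrite -eqA muln_gt0.
have Uw : w \in (A :|: B :|: C) :&: X.
  by move: AXw; rewrite !inE => /andP[-> ->].
have [|x [xn0 xW]] := sys (((A :|: B :|: C) :&: X) :\ w).
  have leU : #|(A :|: B :|: C) :&: X| <= #|Z|.
    rewrite (leq_trans cardU) // -(leq_pmul2l (isT : 0 < 3)) !mulnDr.
    by rewrite eqA eqB addnn -mul2n [leqRHS](mulSnr 2) leq_add2l.
  by rewrite (cardsD1 w) Uw in leU.
exists x; split=> // v Uv; have [->|vw] := eqVneq v w; last first.
  by apply: xW; rewrite !inE vw /=; move: Uv; rewrite !inE.
(* The equation dropped at [w] follows from those of the other vertices of [A]
   and from those of [B], since both parts sum up to the total weight. *)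
have := sum_enclosed_part subZE meetA degA x eqA.
rewrite -(sum_enclosed_part subZE meetB degB x eqB) -/X (big_setD1 w) //=.
rewrite [X in (_ + X = _)%R]big1 => [|u]; last first.
  rewrite 3!inE => /and3P[uw Au Xu]; apply: xW.
  by rewrite !inE uw Au /=; move: Xu; rewrite inE.
rewrite addr0 => ->; apply: big1 => u /setIP[Bu Xu]; apply: xW.
rewrite in_setD1 in_setI !in_setU Bu Xu orbT !andbT.
by apply: contraTneq Bu => ->; case/setIP: AXw => /(disjointFr disjAB)->.
Qed.

(** Restricting the claim to enclosed vertices permits strong induction on [#|Z|]: such a vertex
    sees only edges of [Z]. *)
Lemma two_coloring (Z : {set {set T}}) :
  Z \subset E ->
  exists2 S : {set {set T}}, S \subset Z &
    forall v, v \in (A :|: B :|: C) :&: enclosed E Z ->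
      (exists2 e, e \in S & v \in e) /\
      (exists2 e, e \in E :\: S & v \in e).
Proof.
have [n] := ubnP #|Z|; elim: n Z => // n IHn Z leZn subZE.
have [Z0|Zn0] := eqVneq Z set0.
  exists set0; rewrite ?sub0set // => v /setIP[Uv /enclosedP vZ].
  have /card_gt0P[e] : 0 < #|[set e in E | v \in e]| by rewrite deg3.
  by rewrite inE => /andP[Ee ve]; have := vZ e Ee ve; rewrite Z0 inE.
have [x [[f Zf xf] xX]] := balanced_weights subZE Zn0.
pose Z' := [set e in Z | x e == 0%R].
have subZ' : Z' \subset Z by apply/subsetP=> e; rewrite inE => /andP[].
have [||S subS colS] := IHn Z'.
- rewrite -ltnS; apply: leq_trans leZn; rewrite ltnS; apply/proper_card/properP.
  by split=> //; exists f; rewrite // inE (negPf xf) andbF.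
- exact: subset_trans subZE.
exists (S :|: [set e in Z | (0 < x e)%R]).
  rewrite subUset (subset_trans subS) //.
  by apply/subsetP=> e; rewrite inE => /andP[].
move=> v Uv; have /setIP[Pv Xv] := Uv.
(* If all edges at [v] have weight 0, adding the positive edges to [S] changes nothing at [v], and
   the inductive colouring serves. *)
have [Xv'|] := boolP (v \in enclosed E Z').
  have [|[e Se ve] [g /setDP[Eg Sg] vg]] := colS v; first by rewrite in_setI Pv.
  split; [exists e | exists g]; rewrite // !inE ?Se // Eg (negPf Sg) /= andbT.
  have /enclosedP/(_ g Eg vg) := Xv'; rewrite inE => /andP[_ /eqP->].
  by rewrite ltxx andbF.
(* Otherwise some edge at [v] has nonzero weight; as the weights there sum to 0, both signs
   occur. *)
rewrite inE negb_forall_in => /exists_inP[e Ee].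
rewrite negb_imply => /andP[ve Z'e].
have Ze : e \in Z by move/enclosedP: Xv; apply.
have xe : x e != 0%R by apply: contraNneq Z'e => xe; rewrite inE Ze xe /=.
have x0v := xX v Uv; have Ze_v : (e \in Z) && (v \in e) by rewrite Ze.
split.
  have [g /andP[Zg vg] xg] := sum0_pos x0v Ze_v xe.
  by exists g; rewrite // !inE Zg xg orbT.
have [||g /andP[Zg vg]] := @sum0_pos rat _
  (fun g => (g \in Z) && (v \in g)) (fun g => - x g)%R e _ Ze_v.
- by rewrite sumrN x0v oppr0.
- by rewrite oppr_eq0.
rewrite oppr_gt0 => xg; exists g; rewrite // !inE (subsetP subZE) // andbT.
rewrite ltNge (ltW xg) andbF orbF.
(* The edges of the inductive [S] have weight 0, so the negative edge [g] is not among them. *)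
by apply: contraTN xg => /(subsetP subS); rewrite inE => /andP[_ /eqP->].
Qed.

End Tripartite.

Theorem proposition3p1 (T : finType) (H : hypergraph T)
    (Huniform : uniform 3 H) (Htripartite : tripartite H)
    (Hregular : regular 3 H) :
  exists C : hypergraph T,
    spanning_subhypergraph C H /\
    forall v, v \in vertices C -> degree C v = 1 \/ degree C v = 2.
Proof.
have [A [B [D [defV [disjAB _ _] meets]]]] := Htripartite.
have [meetA meetB meetD] :
    [/\ forall e, e \in edges H -> #|e :&: A| = 1,
        forall e, e \in edges H -> #|e :&: B| = 1 &
        forall e, e \in edges H -> #|e :&: D| = 1].
  by split=> e /meets[].
have deg3 : forall v, v \in A :|: B :|: D -> #|[set e in edges H | v \in e]| = 3.
  by rewrite defV.
have [S subSE colS] := two_coloring disjAB meetA meetB meetD deg3 (subxx (edges H)).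
have subSV e : e \in S -> e \subset vertices H.
  by move=> /(subsetP subSE); apply: edges_sub.
exists (Hypergraph subSV); split=> // v /= Vv.
(* For [Z] the whole edge set, every vertex is enclosed. The edge [e] in [S] makes the degree
   positive, and [f] outside [S] keeps it below 3. *)
have [|[e Se ve] [f /setDP[Ef Sf] vf]] := colS v.
  by rewrite defV inE Vv; apply/enclosedP.
have : degree (Hypergraph subSV) v < 3.
  rewrite -(Hregular v Vv); apply/proper_card/properP; split.
    by apply/subsetP=> g; rewrite !inE => /andP[/(subsetP subSE)-> ->].
  by exists f; rewrite !inE ?Ef ?vf // (negPf Sf).
have : 0 < degree (Hypergraph subSV) v.
  by apply/card_gt0P; exists e; rewrite inE Se.
by case: (degree _ v) => [|[|[|]]] //; [left | right].
Qed.
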